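(* Let $G=(V,E)$ be an undirected graph with $|V|=n$ and $|E|=m$, consider an integer grid of size $H\times W$, and let $k\ge 1$ be an integer. Consider the problem: find a bar $k$-visibility representation of $G$ on the given grid, if one exists. (ILP) There exists an ILP formulation with $O(HW(n+m))$ variables and $O(HW(m^2+n))$ constraints that solves this problem. (SAT) There exists a SAT formulation with $O(HW(n+m))$ variables and $O\bigl(\binom{HW}{k+1}m+HWm^2\bigr)$ clauses of maximum size $HW$ that solves this problem.
   Context: The grid of size $H\times W$ is $\{1,\dots,H\}\times\{1,\dots,W\}$, with height $H$ and width $W$. A bar $k$-visibility representation of $G=(V,E)$ maps all vertices to disjoint horizontal line segments, called bars, and all edges to disjoint vertical bars, such that for each edge $uv\in E$ the bar of $uv$ has its endpoints on the bars for $u$ and $v$ and intersects at most $k$ bars of vertices other than $u$ and $v$. Here disjointness of two edge bars is understood except for the case that they are incident to the same vertex bar and meet at a common endpoint. The representation is on the given grid if all bars are formed by consecutive grid points of one row (vertex bars) or one column (edge bars) of the grid. An ILP formulation is an integer linear program associated with the input (here $G,H,W,k$); a SAT formulation is a set of Boolean clauses associated with the input, whose solutions are the satisfying assignments. A formulation solves the problem if it has a solution exactly when such a representation exists, a solution then describing such a representation. The size of a clause is its number of literals.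
   Formalization: The SAT clause bound has an added term HW times the number of isolated vertices: the stated bound fails e.g. for m = 0 and n > HW, where it allows no clause although no representation exists; for graphs without isolated vertices it is the bound stated. *)

(* Defs.v *)
From HB Require Import structures.
From mathcomp Require Import all_boot all_order all_algebra.

Set Implicit Arguments.
Unset Strict Implicit.
Unset Printing Implicit Defensive.

Record graph := Graph {
  vertex :> finType;
  edges : {set {set vertex}};
  edgesP : forall e, e \in edges -> #|e| = 2 }.

Definition edge (G : graph) := {e : {set G} | e \in edges G}.

(* No bound in the number of edges alone can account for these vertices: without
   edges it allows no clause at all, although a grid with fewer points than the
   graph has vertices admits no representation. *)
Definition isolated (G : graph) : {set G} :=
  [set v | [forall e in edges G, v \notin e]].

(* The point (i, j) lies in row i and column j; both are numbered from 0. *)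
Definition point (H W : nat) := ('I_H * 'I_W)%type.

(* Bars have integer endpoints and are axis-parallel, so two of them intersect
   as segments of the plane exactly when they share a grid point. A bar may
   consist of a single grid point. *)
Record hbar (H W : nat) := HBar {
  hrow : 'I_H;
  hleft : 'I_W;
  hright : 'I_W;
  hbarP : hleft <= hright }.

Record vbar (H W : nat) := VBar {
  vcol : 'I_W;
  vlow : 'I_H;
  vhigh : 'I_H;
  vbarP : vlow <= vhigh }.

Definition hpoints H W (b : hbar H W) : {set point H W} :=
  [set p : point H W | (p.1 == hrow b) && (hleft b <= p.2 <= hright b)].

Definition vpoints H W (b : vbar H W) : {set point H W} :=
  [set p : point H W | (p.2 == vcol b) && (vlow b <= p.1 <= vhigh b)].

Definition vend1 H W (b : vbar H W) : point H W := (vlow b, vcol b).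
Definition vend2 H W (b : vbar H W) : point H W := (vhigh b, vcol b).
Definition vends H W (b : vbar H W) : {set point H W} := [set vend1 b; vend2 b].

Record drawing (G : graph) (H W : nat) := Drawing {
  vertex_bar : G -> hbar H W;
  edge_bar : edge G -> vbar H W }.

Section Representation.

Variables (G : graph) (H W k : nat) (D : drawing G H W).

Definition vertices_disjoint : Prop :=
  forall u v : G, u != v ->
    [disjoint hpoints (vertex_bar D u) & hpoints (vertex_bar D v)].

Definition edges_disjoint : Prop :=
  forall (e f : edge G) (p : point H W), e != f ->
    p \in vpoints (edge_bar D e) -> p \in vpoints (edge_bar D f) ->
    exists v : G, [/\ v \in val e, v \in val f, p \in hpoints (vertex_bar D v),
                      p \in vends (edge_bar D e) & p \in vends (edge_bar D f)].

Definition ends_on_vertices (e : edge G) : Prop :=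
  exists u v : G, [/\ val e = [set u; v],
                      vend1 (edge_bar D e) \in hpoints (vertex_bar D u)
                    & vend2 (edge_bar D e) \in hpoints (vertex_bar D v)].

Definition crossed (e : edge G) : {set G} :=
  [set w | (w \notin val e) &&
           ~~ [disjoint vpoints (edge_bar D e) & hpoints (vertex_bar D w)]].

Definition bar_visibility_representation : Prop :=
  [/\ vertices_disjoint, edges_disjoint
    & forall e : edge G, ends_on_vertices e /\ #|crossed e| <= k].

End Representation.

(* The system lhs *m x <= rhs over the integers. Bounds on single variables
   count as constraints, and an equation counts as two. *)
Record ilp := ILP {
  ilp_vars : nat;
  ilp_cons : nat;
  lhs : 'M[int]_(ilp_cons, ilp_vars);
  rhs : 'cV[int]_ilp_cons }.

Definition feasible (P : ilp) (x : 'cV[int]_(ilp_vars P)) : Prop :=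
  forall i, ((lhs P *m x) i ord0 <= rhs P i ord0)%R.

(* A literal is a variable with the truth value that satisfies it. *)
Record sat := SAT {
  sat_vars : nat;
  clauses : seq (seq ('I_sat_vars * bool)) }.

Definition satisfies (F : sat) (s : 'I_(sat_vars F) -> bool) : Prop :=
  all (has (fun l => s l.1 == l.2)) (clauses F).

(* The solutions describe exactly the representations. In particular there is
   a solution if and only if there is a representation. Asking only for this
   equivalence would admit formulations in which one precomputed representation
   is hard-coded. *)
Definition exactly_describes (G : graph) (H W k : nat) (S : Type)
    (solution : S -> Prop) (describes : S -> drawing G H W -> Prop) : Prop :=
  (forall s, solution s ->
     exists2 D, bar_visibility_representation k D & describes s D) /\
  (forall D, bar_visibility_representation k D ->
     exists2 s, solution s & describes s D).

(* A solution describes a drawing through 0/1 variables, one for each pair of a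
   grid point and a vertex or edge, telling whether the point lies on the bar;
   xv and xe locate these among all variables. *)
Definition ilp_solves (G : graph) (H W k : nat) (P : ilp) : Prop :=
  exists (xv : point H W -> G -> 'I_(ilp_vars P))
         (xe : point H W -> edge G -> 'I_(ilp_vars P)),
    exactly_describes k (@feasible P) (fun x (D : drawing G H W) =>
      (forall p v, x (xv p v) ord0 = (p \in hpoints (vertex_bar D v))%:R%R) /\
      (forall p e, x (xe p e) ord0 = (p \in vpoints (edge_bar D e))%:R%R)).

Definition sat_solves (G : graph) (H W k : nat) (F : sat) : Prop :=
  exists (xv : point H W -> G -> 'I_(sat_vars F))
         (xe : point H W -> edge G -> 'I_(sat_vars F)),
    exactly_describes k (@satisfies F) (fun s (D : drawing G H W) =>
      (forall p v, s (xv p v) = (p \in hpoints (vertex_bar D v))) /\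
      (forall p e, s (xe p e) = (p \in vpoints (edge_bar D e)))).

(* Main.v *)
Require Import Defs.
From HB Require Import structures.
From mathcomp Require Import all_boot all_order all_algebra.
From mathcomp Require Import zify.
From Stdlib Require Import Classical_Prop.

(* The points of a bar form an interval in the row-major (vertices) or
   column-major (edges) order of the grid. With one threshold variable for each
   position of either end, being such an interval takes linearly many clauses of
   at most three literals and one clause of length HW. Along each point, a chain
   of variables forces at most one vertex without comparing all pairs, and its
   last variable records whether the point is occupied. An edge meets a
   horizontal bar in at most one point, so the vertices it crosses are counted
   by the occupied points on it that are not on its end vertices; this count is
   one inequality per edge in the integer program, and one clause per edge and
   set of k+1 points otherwise.

   Clauses of three literals are too long if HW <= 2. Then a drawable graph has
   at most two vertices, and the clauses of length HW that hold in all
   representations already determine the representations. *)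

Set Implicit Arguments.
Unset Strict Implicit.
Unset Printing Implicit Defensive.

Import Order.TTheory GRing.Theory Num.Theory.

(** * Formulations over an arbitrary finite set of variables *)

Section Formulas.

Variable V : finType.
Implicit Types (s : V -> bool) (F : seq (seq (V * bool))).

Definition pos (v : V) := (v, true).
Definition neg (v : V) := (v, false).

Definition models F s : bool := all (has (fun l => s l.1 == l.2)) F.

Lemma models_cat F1 F2 s : models (F1 ++ F2) s = models F1 s && models F2 s.
Proof. exact: all_cat. Qed.

Lemma models_familyP (I : finType) (f : I -> seq (seq (V * bool))) s :
  reflect (forall i, models (f i) s) (models (flatten [seq f i | i <- enum I]) s).
Proof.
apply: (iffP allP) => [h i | h c /flatten_mapP [i _]]; last exact: (allP (h i)).
by apply/allP => c cf; apply: h; apply/flatten_mapP; exists i; rewrite ?mem_enum.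
Qed.

Lemma has_posP (I : finType) (f : I -> V) s :
  reflect (exists i, s (f i))
    (has (fun l => s l.1 == l.2) [seq pos (f i) | i <- enum I]).
Proof.
apply: (iffP hasP) => [[_ /mapP [i _ ->] /eqP si] | [i si]]; first by exists i.
by exists (pos (f i)); [apply: map_f; rewrite mem_enum | rewrite /= si].
Qed.

Lemma size_family (T : Type) (I : finType) (f : I -> seq T) c :
  (forall i, size (f i) <= c) -> size (flatten [seq f i | i <- enum I]) <= c * #|I|.
Proof.
move=> h; rewrite size_flatten /shape -map_comp cardE mulnC.
elim: (enum I) => //= i r IH; rewrite mulSn; exact: leq_add.
Qed.

Definition cnf_sat F : sat :=
  @SAT #|V| [seq [seq (enum_rank l.1, l.2) | l <- c] | c <- F].

Lemma satisfies_cnf F (s : 'I_#|V| -> bool) :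
  satisfies (F := cnf_sat F) s <-> models F (s \o enum_rank).
Proof.
rewrite /satisfies /models /= all_map.
by rewrite (eq_all (a2 := has (fun l => (s \o enum_rank) l.1 == l.2))) // => c;
  rewrite /= has_map.
Qed.

(** * Integer programs with 0/1 variables *)

Local Open Scope ring_scope.

Definition ineqs_ilp (L : seq ({ffun V -> int} * int)) : ilp :=
  @ILP #|V| (size L)
    (\matrix_(i, j) (tnth (in_tuple L) i).1 (enum_val j))
    (\col_i (tnth (in_tuple L) i).2).

Lemma feasible_ineqs L (x : 'cV[int]_#|V|) :
  feasible (P := ineqs_ilp L) x <->
  forall c, c \in L -> \sum_v c.1 v * x (enum_rank v) ord0 <= c.2.
Proof.
have E (i : 'I_(size L)) : (lhs (ineqs_ilp L) *m x) i ord0 =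
    \sum_v (tnth (in_tuple L) i).1 v * x (enum_rank v) ord0.
  rewrite !mxE (reindex enum_rank) /=; last first.
    by apply: onW_bij; exact: enum_rank_bij.
  by apply: eq_bigr => v _; rewrite !mxE enum_rankK.
split=> [h c cL | h i].
  have /tnthP [i ->] : c \in in_tuple L by [].
  by have := h i; rewrite E mxE.
by rewrite E mxE; apply: h; rewrite (mem_tnth i (in_tuple L)).
Qed.

(** A clause asks that its literals sum to at least 1, a negative literal having the value 1 - x.
    Negating the sum and moving the constants to the right gives this inequality. *)
Definition clause_ineq (c : seq (V * bool)) : {ffun V -> int} * int :=
  ([ffun v => \sum_(l <- c) (if l.2 then -1 else 1) * (l.1 == v)%:R],
   \sum_(l <- c) (~~ l.2)%:R - 1).

Definition at_most (A : {set V} * nat) : {ffun V -> int} * int :=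
  ([ffun v => (v \in A.1)%:R], A.2%:R).

Lemma sum_delta (v : V) (f g : V -> int) :
  (forall w, w != v -> f w = 0) -> \sum_w f w * g w = f v * g v.
Proof.
by move=> f0; rewrite (bigD1 v) //= big1 ?addr0 // => w /f0 ->; rewrite mul0r.
Qed.

Definition bound_ineqs (v : V) : seq ({ffun V -> int} * int) :=
  [:: ([ffun w => - (w == v)%:R], 0); ([ffun w => (w == v)%:R], 1)].

Definition cnf_ilp F (K : seq ({set V} * nat)) : ilp :=
  ineqs_ilp (flatten [seq bound_ineqs v | v <- enum V] ++
             [seq clause_ineq c | c <- F] ++ [seq at_most A | A <- K]).

Lemma clause_ineqP c s :
  (\sum_v (clause_ineq c).1 v * (s v)%:R <= (clause_ineq c).2) =
  has (fun l => s l.1 == l.2) c.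
Proof.
have -> : \sum_v (clause_ineq c).1 v * (s v)%:R =
    \sum_(l <- c) (if l.2 then -1 else 1) * (s l.1)%:R.
  under eq_bigr => v _ do rewrite ffunE big_distrl /=.
  rewrite exchange_big /=; apply: eq_bigr => l _.
  rewrite (bigD1 l.1) //= eqxx mulr1 big1 ?addr0 // => v /negPf.
  by rewrite eq_sym => ->; rewrite mulr0 mul0r.
(* The number of negative literals exceeds the left-hand side by exactly the number of true
   literals. *)
have E : \sum_(l <- c) (~~ l.2)%:R = \sum_(l <- c) (if l.2 then -1 else 1) * (s l.1)%:R
     + (count (fun l => s l.1 == l.2) c)%:R :> int.
  elim: c => [|l c IH]; first by rewrite !big_nil.
  rewrite !big_cons /= IH natrD.
  by case: (l.2) (s l.1) => [] [] /=; rewrite ?mulr1 ?mulr0 ?mulN1r ?mul1r; lia.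
rewrite /clause_ineq /= E has_count.
by rewrite -addrA lerDl subr_ge0 ler1n.
Qed.

(** The bounds confine each integer variable to 0 and 1, so a solution is a truth assignment, on
    which the other inequalities have their intended meaning. *)
Lemma cnf_ilpP F K (x : 'cV[int]_#|V|) :
  feasible (P := cnf_ilp F K) x <->
  exists s, [/\ forall v, x (enum_rank v) ord0 = (s v)%:R, models F s &
                forall A, A \in K -> (#|[set v in A.1 | s v]| <= A.2)%N].
Proof.
have sumK s (A : {set V} * nat) :
    (\sum_v (at_most A).1 v * (s v)%:R <= (at_most A).2) =
    (#|[set v in A.1 | s v]| <= A.2)%N.
  rewrite -(ler_nat int) -sum1_card natr_sum [in RHS]big_mkcond /=.
  congr (_ <= _); apply: eq_bigr => v _; rewrite ffunE inE.
  by case: (v \in A.1); case: (s v).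
rewrite feasible_ineqs; split=> [h | [s [xE sF sK]] c].
  pose s v := x (enum_rank v) ord0 == 1.
  have xE v : x (enum_rank v) ord0 = (s v)%:R.
    have sub c : c \in bound_ineqs v -> \sum_w c.1 w * x (enum_rank w) ord0 <= c.2.
      move=> cv; apply: h; rewrite mem_cat; apply/orP; left.
      by apply/flatten_mapP; exists v; rewrite ?mem_enum.
    have := sub _ (mem_last _ _); have := sub _ (mem_head _ _).
    rewrite /= !(sum_delta (v := v)) => [|w /negPf wv|w /negPf wv]; last first.
    - by rewrite ffunE wv ?oppr0.
    - by rewrite ffunE wv ?oppr0.
    rewrite !ffunE eqxx mulN1r mul1r oppr_le0 /s.
    by case: eqP => [->|] //=; lia.
  have xsum (f : V -> int) : \sum_v f v * x (enum_rank v) ord0 = \sum_v f v * (s v)%:R.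
    by apply: eq_bigr => v _; rewrite xE.
  exists s; split=> //.
    apply/allP => c cF; rewrite -clause_ineqP -xsum; apply: h.
    by rewrite !mem_cat map_f ?orbT.
  by move=> A AK; rewrite -sumK -xsum; apply: h; rewrite !mem_cat map_f ?orbT.
have xsum (f : V -> int) : \sum_v f v * x (enum_rank v) ord0 = \sum_v f v * (s v)%:R.
  by apply: eq_bigr => v _; rewrite xE.
rewrite xsum !mem_cat => /or3P [/flatten_mapP [v _] | /mapP [d dF ->] | /mapP [A AK ->]].
- rewrite !inE => /orP [] /eqP -> /=; rewrite (sum_delta (v := v)) => [|w].
  + by rewrite ffunE eqxx; case: (s v).
  + by rewrite ffunE => /negPf ->; rewrite ?oppr0.
  + by rewrite ffunE eqxx; case: (s v).
  + by rewrite ffunE => /negPf ->.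
- by rewrite clause_ineqP; apply: (allP sF).
- by rewrite sumK; apply: sK.
Qed.

Lemma ilp_cons_cnf F K :
  (ilp_cons (cnf_ilp F K) <= 2 * #|V| + size F + size K)%N.
Proof.
rewrite /= !size_cat !size_map addnA !leq_add2r.
exact: (size_family (c := 2)).
Qed.

End Formulas.

(** * The clauses of a formulation *)

Lemma leq_lex (a b c d w : nat) : b < w -> d < w ->
  (a * w + b <= c * w + d) = (a < c) || (a == c) && (b <= d).
Proof.
move=> bw dw; case: (ltngtP a c) => [ac|ca|->] /=; last by rewrite leq_add2l.
  by have : a.+1 * w <= c * w by [rewrite leq_mul2r ac orbT]; lia.
by have : c.+1 * w <= a * w by [rewrite leq_mul2r ca orbT]; lia.
Qed.

(** The least [r] with [A r] is positive because [A 0] fails; its predecessor is the threshold. *)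
Lemma threshold (N : nat) (A : nat -> bool) :
  ~~ A 0 -> A N -> (forall r, r < N -> A r -> A r.+1) ->
  exists2 a, a < N & forall r, r <= N -> A r = (a < r).
Proof.
move=> A0 AN Amono; case: (ex_minnP (ex_intro A N AN)) => m Am m_min.
have m_gt0 : 0 < m by case: m Am {m_min} => //; rewrite (negPf A0).
have mN : m <= N by apply: m_min.
exists m.-1 => [|r rN]; first by rewrite prednK.
rewrite prednK //; apply/idP/idP => [/m_min //|].
elim: r rN => [|r IH] rN; first by rewrite leqNgt m_gt0.
by rewrite leq_eqVlt ltnS => /orP [/eqP <- //|mr]; apply/Amono/IH => //; exact: ltnW.
Qed.

(** * Bars as intervals of ranks *)

Section Formulation.

Variables (G : graph) (H W : nat).
Hypotheses (H_gt0 : 0 < H) (W_gt0 : 0 < W).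

Local Notation pt := (point H W).

(* Vertices and edges alike are drawn as intervals of the grid points, ordered
   row by row for a vertex and column by column for an edge, that do not extend
   over several lines. *)
Definition object : finType := (G + edge G)%type.

Definition rank (o : object) (p : pt) : nat :=
  match o with inl _ => p.1 * W + p.2 | inr _ => p.2 * H + p.1 end.

Definition line (o : object) (p : pt) : nat :=
  match o with inl _ => p.1 | inr _ => p.2 end.

Definition line_start (o : object) (p : pt) : bool :=
  match o with inl _ => p.2 == 0 :> nat | inr _ => p.1 == 0 :> nat end.

Definition opoints (D : drawing G H W) (o : object) : {set pt} :=
  match o with
  | inl v => hpoints (vertex_bar D v)
  | inr e => vpoints (edge_bar D e)
  end.

Definition first_point (D : drawing G H W) (o : object) : pt :=
  match o with
  | inl v => (hrow (vertex_bar D v), hleft (vertex_bar D v))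
  | inr e => vend1 (edge_bar D e)
  end.

Definition last_point (D : drawing G H W) (o : object) : pt :=
  match o with
  | inl v => (hrow (vertex_bar D v), hright (vertex_bar D v))
  | inr e => vend2 (edge_bar D e)
  end.

Lemma rank_lt o p : rank o p < H * W.
Proof. by case: o p => [v|e] [i j] /=; have := ltn_ord i; have := ltn_ord j; nia. Qed.

Lemma rank_onto o r : r < H * W -> exists p, rank o p = r.
Proof.
case: o => x rN.
  have rH : r %/ W < H by rewrite ltn_divLR.
  by exists (Ordinal rH, Ordinal (ltn_pmod r W_gt0)); rewrite /= -divn_eq.
have rW : r %/ H < W by rewrite ltn_divLR // mulnC.
by exists (Ordinal (ltn_pmod r H_gt0), Ordinal rW); rewrite /= -divn_eq.
Qed.

Lemma rank_vertex (v : G) (p q : pt) :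
  (rank (inl v) p <= rank (inl v) q) = (p.1 < q.1) || (p.1 == q.1) && (p.2 <= q.2).
Proof. exact: leq_lex. Qed.

Lemma rank_edge (e : edge G) (p q : pt) :
  (rank (inr e) p <= rank (inr e) q) = (p.2 < q.2) || (p.2 == q.2) && (p.1 <= q.1).
Proof. exact: leq_lex. Qed.

(** The first and the last point share a line, so the rank interval between them never leaves that
    line. *)
Lemma opoints_rank D o p :
  (p \in opoints D o) =
  (rank o (first_point D o) <= rank o p <= rank o (last_point D o)).
Proof.
case: o => [v|e]; rewrite ?(rank_vertex v) ?(rank_edge e) /= inE -!val_eqE /=;
  last first.
  by case: (edge_bar D e) => c l h lh /=; lia.
by case: (vertex_bar D v) => c l h lh /=; lia.
Qed.

Lemma line_first_last D o : line o (first_point D o) = line o (last_point D o).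
Proof. by case: o. Qed.

Lemma rank_first_last D o : rank o (first_point D o) <= rank o (last_point D o).
Proof.
case: o => [v|e]; rewrite ?rank_vertex ?rank_edge /= eqxx.
  by rewrite hbarP orbT.
by rewrite vbarP orbT.
Qed.

(* Once a point of a later line is reached, so is the start of that line. *)
Lemma line_startP o p q : rank o p <= rank o q ->
  line o p = line o q <->
  (forall r, line_start o r -> ~~ (rank o p < rank o r <= rank o q)).
Proof.
move=> pq; split=> [|h].
  case: o {pq} => [v|e] pq r r0.
    by move: pq r0; rewrite ltnNge !(rank_vertex v) /= -!val_eqE /= => ->; lia.
  by move: pq r0; rewrite ltnNge !(rank_edge e) /= -!val_eqE /= => ->; lia.
case: o pq h => [v|e] pq h; apply/eqP.
  have := h (q.1, Ordinal W_gt0) erefl; rewrite ltnNge.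
  by move: pq; rewrite !(rank_vertex v) /= -!val_eqE /=; lia.
have := h (Ordinal H_gt0, q.2) erefl; rewrite ltnNge.
by move: pq; rewrite !(rank_edge e) /= -!val_eqE /=; lia.
Qed.

(** * Variables and clauses of the encoding *)

Variable endv : edge G -> bool -> G.
Hypothesis endvE : forall e, val e = [set endv e true; endv e false].

Local Notation N := (H * W).
Local Notation obj := object.

(** Prefixes of the vertices and thresholds for ranks take one value more than there are vertices or
    ranks, hence the successors. *)
Definition variable : finType :=
  ((pt * obj + pt * 'I_#|G|.+1) +
   (obj * bool * 'I_N.+1 + edge G * pt * (bool + option bool)))%type.

Definition on_bar (o : obj) (p : pt) : variable := inl (inl (p, o)).
(* One of the first [i] vertices occupies [p]. *)
Definition seen (p : pt) (i : nat) : variable := inl (inr (p, inord i)).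
(* The first point of [o] has rank less than [r]. *)
Definition started (o : obj) (r : nat) : variable := inr (inl (o, true, inord r)).
(* The last point of [o] has rank at least [r]. *)
Definition unfinished (o : obj) (r : nat) : variable := inr (inl (o, false, inord r)).
(* [p] lies on [e] and on its end vertex number [b]. *)
Definition touch (e : edge G) (b : bool) (p : pt) : variable := inr (inr (e, p, inl b)).
(* [p] lies on [e] and on one of its end vertices. *)
Definition anchor (e : edge G) (p : pt) : variable := inr (inr (e, p, inr None)).
(* [p] lies on [e] and on some vertex. *)
Definition occupied (e : edge G) (p : pt) : variable := inr (inr (e, p, inr (Some true))).
(* [p] lies on [e] and on a vertex that is not an end vertex of [e]. *)
Definition crossing (e : edge G) (p : pt) : variable := inr (inr (e, p, inr (Some false))).

Notation clause := (seq (variable * bool)).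

(** A sequential counter for at most one vertex. The chain may also switch on without a vertex,
    which can only force more crossings. *)
Definition vertex_point_clauses (pv : pt * G) : seq clause :=
  let: (p, v) := pv in let i : nat := enum_rank v in
  [:: [:: neg (on_bar (inl v) p); pos (seen p i.+1)];
      [:: neg (seen p i); pos (seen p i.+1)];
      [:: neg (on_bar (inl v) p); neg (seen p i)]].

Definition object_clauses (o : obj) : seq clause :=
  [:: [seq pos (on_bar o p) | p <- enum {: pt}];
      [:: neg (started o 0)]; [:: neg (unfinished o N)]].

(** The first two clauses make the threshold chains monotone; the next three identify the bar with
    the points between both thresholds. The last one, present only at the start of a line, keeps a
    bar from continuing there from the previous line. *)
Definition object_point_clauses (op : obj * pt) : seq clause :=
  let: (o, p) := op in let r := rank o p in
  [:: [:: neg (started o r); pos (started o r.+1)];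
      [:: neg (unfinished o r.+1); pos (unfinished o r)];
      [:: neg (on_bar o p); pos (started o r.+1)];
      [:: neg (on_bar o p); pos (unfinished o r)];
      [:: neg (started o r.+1); neg (unfinished o r); pos (on_bar o p)]]
  ++ nseq (line_start o p) [:: neg (started o r); neg (unfinished o r)].

(** Anchored end points alone could both lie on the same vertex; a contact with each end vertex
    excludes this. *)
Definition edge_clauses (e : edge G) : seq clause :=
  [:: [seq pos (touch e true p) | p <- enum {: pt}];
      [seq pos (touch e false p) | p <- enum {: pt}]].

(** An end point of the edge is recognized as the rank where a threshold variable changes its value,
    and it must be an anchor. The variable [occupied] splits a condition on four variables into
    clauses of at most three literals. *)
Definition edge_point_clauses (ep : edge G * pt) : seq clause :=
  let: (e, p) := ep in let r := rank (inr e) p in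
  [:: [:: neg (touch e true p); pos (on_bar (inr e) p)];
      [:: neg (touch e true p); pos (on_bar (inl (endv e true)) p)];
      [:: neg (touch e false p); pos (on_bar (inr e) p)];
      [:: neg (touch e false p); pos (on_bar (inl (endv e false)) p)];
      [:: neg (started (inr e) r.+1); pos (started (inr e) r); pos (anchor e p)];
      [:: neg (unfinished (inr e) r); pos (unfinished (inr e) r.+1); pos (anchor e p)];
      [:: neg (anchor e p); pos (on_bar (inl (endv e true)) p);
          pos (on_bar (inl (endv e false)) p)];
      [:: neg (on_bar (inr e) p); neg (seen p #|G|); pos (occupied e p)];
      [:: neg (occupied e p); pos (crossing e p); pos (anchor e p)]].

(** The second clause forbids that [p] is interior to [e], with parts of [e] strictly before and
    strictly after it. The pair [(f, e)] gives the same for [f]. *)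
Definition edges_point_clauses (efp : edge G * edge G * pt) : seq clause :=
  let: (e, f, p) := efp in let r := rank (inr e) p in
  if e == f then [::] else
  [:: [:: neg (on_bar (inr e) p), neg (on_bar (inr f) p)
        & [seq pos (on_bar (inl v) p) | v <- enum (val e :&: val f)]];
      [:: neg (on_bar (inr f) p); neg (started (inr e) r);
          neg (unfinished (inr e) r.+1)]].

Definition family (I : finType) (f : I -> seq clause) : seq clause :=
  flatten [seq f i | i <- enum I].

Definition base_clauses : seq clause :=
  family vertex_point_clauses ++ family object_clauses ++
  family object_point_clauses ++ family edge_clauses ++
  family edge_point_clauses ++ family edges_point_clauses.

Definition crossings (s : variable -> bool) (e : edge G) : {set pt} :=
  [set p | s (crossing e p)].

(** * Numbers of variables, clauses and literals *)

Lemma card_edge : #|{: edge G}| = #|edges G|.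
Proof. by rewrite card_sig; apply: eq_card. Qed.

Lemma card_point : #|{: pt}| = N.
Proof. by rewrite card_prod !card_ord. Qed.

Lemma N_gt0 : 0 < N. Proof. by rewrite muln_gt0 H_gt0. Qed.

(** The chain at each point has one variable more than there are vertices; a nonempty vertex set
    absorbs these [N] extra variables. *)
Lemma card_variable : 0 < #|G| -> #|variable| <= 12 * (N * (#|G| + #|edges G|)).
Proof.
move=> G_gt0; rewrite !card_sum !card_prod !card_sum !card_ord card_bool card_option.
rewrite card_bool card_edge.
have := N_gt0; move: #|G| #|edges G| (H * W) G_gt0 => n m M n_gt0 M_gt0.
have Mn : n <= M * n by rewrite leq_pmull.
have Mm : m <= M * m by rewrite leq_pmull.
have nM : M <= M * n by rewrite leq_pmulr.
lia.
Qed.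

Lemma size_base :
  size base_clauses <= 12 * (N * #|G|) + 22 * (N * #|edges G| ^ 2).
Proof.
have sF := @size_family clause.
have s1 : size (family vertex_point_clauses) <= 3 * #|{: pt * G}| by apply: sF; case.
have s2 : size (family object_clauses) <= 3 * #|{: obj}| by apply: sF.
have s3 : size (family object_point_clauses) <= 6 * #|{: obj * pt}|.
  by apply: sF => -[o p]; rewrite size_cat size_nseq; case: line_start.
have s4 : size (family edge_clauses) <= 2 * #|{: edge G}| by apply: sF.
have s5 : size (family edge_point_clauses) <= 9 * #|{: edge G * pt}| by apply: sF; case.
have s6 : size (family edges_point_clauses) <= 2 * #|{: edge G * edge G * pt}|.
  by apply: sF => -[[e f] p] /=; case: eqP.
move: s1 s2 s3 s4 s5 s6; rewrite /base_clauses !size_cat.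
rewrite !card_prod !card_sum !card_ord card_edge.
have := N_gt0; move: #|G| #|edges G| (H * W) => n m M M_gt0.
have Mn : n <= M * n by rewrite leq_pmull.
have Mm : m <= M * m by rewrite leq_pmull.
have Mm2 : M * m <= M * m ^ 2 by rewrite leq_mul2l -mulnn; nia.
rewrite -mulnn in Mm2 *; lia.
Qed.

Lemma base_clause_size c : c \in base_clauses -> size c <= maxn 3 N.
Proof.
rewrite !mem_cat => /orP [|/orP [|/orP [|/orP [|/orP [|]]]]] /flatten_mapP [].
- by case=> p v _; rewrite !inE leq_max => /or3P [] /eqP ->.
- move=> o _; rewrite !inE leq_max => /or3P [] /eqP -> //.
  by rewrite size_map -cardE card_point leqnn orbT.
- case=> o p _; rewrite !inE leq_max mem_nseq.
  by do 5!(case/orP => [/eqP -> //|]); move=> /andP [_ /eqP ->].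
- move=> e _; rewrite !inE leq_max.
  by case/orP => /eqP ->; rewrite size_map -cardE card_point leqnn orbT.
- by case=> e p _; rewrite !inE leq_max; do 8!(case/orP => [/eqP -> //|]); move=> /eqP ->.
- case=> [[e f] p] _ /=; case: eqP => // nef; rewrite !inE leq_max.
  case/orP => /eqP -> //; rewrite /= size_map -cardE !ltnS.
  (* Two distinct edges share at most one vertex, so the clause has at most three literals. *)
  rewrite leqNgt; apply/orP; left; apply/negP => ef2.
  have e2 : #|val e| = 2 by apply: edgesP (valP e).
  have f2 : #|val f| = 2 by apply: edgesP (valP f).
  apply: nef; apply: val_inj; apply/eqP; rewrite eqEcard e2 f2 leqnn andbT.
  have /eqP <- : val e :&: val f == val e by rewrite eqEcard subsetIl e2.
  exact: subsetIr.
Qed.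

Lemma vends_rank (e : edge G) (b : vbar H W) p : p \in vpoints b ->
  (rank (inr e) p <= rank (inr e) (vend1 b)) || (rank (inr e) (vend2 b) <= rank (inr e) p) ->
  p \in vends b.
Proof.
case: p => i j; rewrite !(rank_edge e) !inE /vend1 /vend2 !xpair_eqE /= -!val_eqE /=.
lia.
Qed.

(** * From assignments to drawings *)

Section Soundness.

Variable s : variable -> bool.
Hypothesis sound : models (base_clauses) s.

Lemma base_families :
  [/\ forall pv, models (vertex_point_clauses pv) s,
      forall o, models (object_clauses o) s,
      forall op, models (object_point_clauses op) s,
      forall e, models (edge_clauses e) s &
      (forall ep, models (edge_point_clauses ep) s) /\
      (forall efp, models (edges_point_clauses efp) s)].
Proof.
move: sound; rewrite /base_clauses !models_cat => /and5P [h1 h2 h3 h4].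
move=> /andP [h5 h6].
by split; last split; apply/models_familyP.
Qed.

(** Along the ranks, [started] switches on once and [unfinished] switches off once; the bar lies
    between the two switches, and no start of a line separates its ends. *)
Lemma object_interval (o : obj) : exists p q : pt,
  [/\ rank o p <= rank o q, line o p = line o q,
      forall x, s (on_bar o x) = (rank o p <= rank o x <= rank o q) &
      forall r, r <= N -> s (started o r) = (rank o p < r) /\
                          s (unfinished o r) = (r <= rank o q)].
Proof.
have [_ /(_ o) ho hop _ _] := base_families.
have [x0 x0_on] : exists x, s (on_bar o x).
  by apply/has_posP; case/andP: ho.
move: ho; rewrite /models /= !orbF !eqbF_neg => /and4P [_ s0 uN _].
have hr p : [/\ s (started o (rank o p)) -> s (started o (rank o p).+1),
   s (unfinished o (rank o p).+1) -> s (unfinished o (rank o p)),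
   s (on_bar o p) -> s (started o (rank o p).+1) /\ s (unfinished o (rank o p)),
   s (started o (rank o p).+1) -> s (unfinished o (rank o p)) -> s (on_bar o p) &
   line_start o p -> s (started o (rank o p)) -> ~~ s (unfinished o (rank o p))].
  have := hop (o, p); rewrite /models /= !orbF !eqbF_neg !eqb_id.
  rewrite all_nseq /= !eqbF_neg orbF => /and5P [h1 h2 h3 h4 /andP [h5 h6]].
  split.
  - by move=> e; rewrite e in h1.
  - by move=> e; rewrite e in h2.
  - by move=> e; rewrite e in h3 h4.
  - by move=> e e'; rewrite e e' in h5.
  - by move=> e e'; rewrite e e' in h6.
have [a aN started_a] : exists2 a, a < N & forall r, r <= N -> s (started o r) = (a < r).
  apply: threshold => // [|r rN].
    (* From a point on the bar, monotonicity carries [started] up to [N]. *)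
    have [_ _ /(_ x0_on) [st _] _ _] := hr x0.
    have : forall d, rank o x0 + d.+1 <= N -> s (started o (rank o x0 + d.+1)).
      elim=> [|d IH] dN; first by rewrite addn1.
      have [y yr] : exists y, rank o y = rank o x0 + d.+1 by apply: rank_onto; lia.
      by have [+ _ _ _ _] := hr y; rewrite yr !addnS -addnS => -> //; apply: IH; lia.
    move=> /(_ (N - (rank o x0).+1)).
    by have := rank_lt o x0; rewrite -addSnnS => xN; rewrite subnKC //; apply.
  by have [y <-] := rank_onto o rN; case: (hr y).
have [b bN unfinished_b] : exists2 b, b < N &
    forall r, r <= N -> s (unfinished o r) = (r <= b).
  (* The negation of [unfinished] is increasing; it fails at 0 by descending from the same point of
     the bar. *)
  have [||r rN|b bN hb] := threshold (N := N) (A := fun r => ~~ s (unfinished o r)).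
  - rewrite negbK; have [_ _ /(_ x0_on) [_ uf] _ _] := hr x0.
    have : forall d, d <= rank o x0 -> s (unfinished o (rank o x0 - d)).
      elim=> [|d IH] dN; first by rewrite subn0.
      have [y yr] : exists y, rank o y = rank o x0 - d.+1.
        by apply: rank_onto; have := rank_lt o x0; lia.
      have [_ + _ _ _] := hr y; rewrite yr => -> //.
      by rewrite -subSn // subSS; apply: IH; lia.
    by move=> /(_ (rank o x0)); rewrite subnn; apply.
  - exact: uN.
  - by have [y <-] := rank_onto o rN; case: (hr y) => _ h _ _ _; apply: contra.
  - by exists b => // r rN; apply: negb_inj; rewrite hb // ltnNge.
have [p pa] := rank_onto o aN; have [q qb] := rank_onto o bN.
have on_ab x : s (on_bar o x) = (a <= rank o x <= b).
  have xN := rank_lt o x; have := started_a _ xN; have := unfinished_b _ (ltnW xN).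
  rewrite ltnS; have [_ _ h1 h2 _] := hr x.
  move=> eb ea; apply/idP/idP => [/h1 [] | /andP []].
    by rewrite ea eb => -> ->.
  by rewrite -ea -eb.
have ab : a <= b by have := on_ab x0; rewrite x0_on => /esym /andP [/leq_trans]; apply.
exists p, q; rewrite pa qb; split=> //.
  apply/line_startP => //; first by rewrite pa qb.
  move=> r r0; have [_ _ _ _ /(_ r0)] := hr r.
  have rN := ltnW (rank_lt o r); rewrite started_a // unfinished_b // pa qb.
  by case: (a < _) => // ->.
by move=> r rN; rewrite started_a ?unfinished_b.
Qed.

Lemma vertex_bar_exists (v : G) :
  exists b : hbar H W, forall p, s (on_bar (inl v) p) = (p \in hpoints b).
Proof.
have [p [q []]] := object_interval (inl v); rewrite (rank_vertex v) /= => pq l on _.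
have pq2 : p.2 <= q.2 by move: pq; rewrite -!val_eqE /=; lia.
exists (HBar p.1 pq2) => x; rewrite on !(rank_vertex v) inE /= -!val_eqE /=; lia.
Qed.

(** The threshold values are kept besides the points, since the clauses on end points of edges are
    stated through them. *)
Lemma edge_bar_exists (e : edge G) : exists b : vbar H W,
  (forall p, s (on_bar (inr e) p) = (p \in vpoints b)) /\
  (forall r, r <= N ->
     s (started (inr e) r) = (rank (inr e) (vend1 b) < r) /\
     s (unfinished (inr e) r) = (r <= rank (inr e) (vend2 b))).
Proof.
have [p [q []]] := object_interval (inr e); rewrite (rank_edge e) => pq l on se.
have pq2 : p.1 <= q.1 by move: pq l; rewrite -!val_eqE /=; lia.
exists (VBar p.2 pq2); split.
  by move=> x; rewrite on !(rank_edge e) inE /= -!val_eqE /=; move: l => /=; lia.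
have -> : vend2 (VBar p.2 pq2) = q.
  by rewrite /vend2 /= (val_inj l); case: (q).
by have -> : vend1 (VBar p.2 pq2) = p by rewrite /vend1 /=; case: (p).
Qed.

Lemma seen_mono (p : pt) i j : i <= j <= #|G| -> s (seen p i) -> s (seen p j).
Proof.
have [hv _ _ _ _] := base_families.
case/andP; elim: j => [|j IH]; first by rewrite leqn0 => /eqP ->.
rewrite leq_eqVlt => /orP [/eqP <- // | ij] jn si.
have /= := hv (p, enum_val (Ordinal jn)).
rewrite /models /= enum_valK /= !eqbF_neg !eqb_id !orbF => /and3P [_ + _].
by rewrite IH // ltnW.
Qed.

Lemma vertex_seen (p : pt) (v : G) : s (on_bar (inl v) p) -> s (seen p #|G|).
Proof.
have [hv _ _ _ _] := base_families; have := hv (p, v).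
rewrite /models /= !eqbF_neg !eqb_id !orbF => /and3P [h _ _] sv.
rewrite sv in h; apply: seen_mono h; rewrite leqnn andbT; exact: ltn_ord.
Qed.

(** The earlier of two vertices switches the chain on before the index of the later one, which is
    then forbidden at [p]. *)
Lemma at_most_one_vertex (p : pt) (u v : G) :
  s (on_bar (inl u) p) -> s (on_bar (inl v) p) -> u = v.
Proof.
have [hv _ _ _ _] := base_families.
wlog uv : u v / enum_rank u < enum_rank v.
  move=> th su sv; case: (ltngtP (enum_rank u) (enum_rank v)) => [uv|vu|/val_inj].
  - exact: th.
  - by rewrite (th _ _ vu).
  - exact: enum_rank_inj.
move=> su sv; have := hv (p, u); have := hv (p, v).
rewrite /models /= !eqbF_neg !eqb_id !orbF su sv /= => /and3P [_ _ nv] /andP [su' _].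
by rewrite (seen_mono _ su') // uv ltnW in nv.
Qed.

Variable k : nat.
Hypothesis few_crossings : forall e, #|crossings s e| <= k.

(** Each point carries at most one vertex. Hence vertex bars are disjoint, and each vertex crossed
    by an edge accounts for a point of its own in [crossings]. *)
Theorem sound_drawing : exists2 D : drawing G H W, bar_visibility_representation k D &
  forall p o, s (on_bar o p) = (p \in opoints D o).
Proof.
have [vb vbE] := fin_all_exists vertex_bar_exists.
have [eb ebE] := fin_all_exists edge_bar_exists.
pose D := Drawing vb eb.
have on_D p o : s (on_bar o p) = (p \in opoints D o).
  by case: o => [v|e]; [apply: vbE | case: (ebE e) => + _; apply].
have [_ _ _ he [hep hefp]] := base_families.
have anchorP (e : edge G) p : s (anchor e p) -> exists2 v, v \in val e & p \in opoints D (inl v).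
  have := hep (e, p); rewrite /models; do 6!(case/andP=> _); case/andP=> + _.
  rewrite /= !eqbF_neg !eqb_id orbF !on_D => h a; rewrite a /= in h.
  by case/orP: h => h; [exists (endv e true) | exists (endv e false)];
    rewrite // endvE !inE eqxx ?orbT.
have touchP (e : edge G) v : v \in val e ->
    exists2 p, p \in vpoints (eb e) & p \in hpoints (vb v).
  rewrite endvE !inE => ve; have := he e; rewrite /models /= andbT => /andP [t1 t2].
  have [b vb'] : exists b, v = endv e b.
    by case/orP: ve => /eqP ->; [exists true | exists false].
  have [p tp] : exists p, s (touch e b p).
    by case: b {vb'}; apply/has_posP.
  have := hep (e, p); rewrite /models /= !eqbF_neg !eqb_id !orbF !on_D.
  move=> /and5P [h1 h2 h3 h4 _]; exists p.
    by case: b tp {vb'} => tp; rewrite tp in h1 h3.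
  by rewrite vb'; case: b tp {vb'} => tp; rewrite tp in h2 h4.
have anchor1 (e : edge G) : s (anchor e (vend1 (eb e))).
  have := hep (e, vend1 (eb e)); rewrite /models; do 4!(case/andP=> _); case/andP=> + _.
  have [_ st] := ebE e; have r1 := rank_lt (inr e) (vend1 (eb e)).
  rewrite /= !eqbF_neg !eqb_id orbF (st _ r1).1 (st _ (ltnW r1)).1.
  by rewrite ltnn ltnSn.
have anchor2 (e : edge G) : s (anchor e (vend2 (eb e))).
  have := hep (e, vend2 (eb e)); rewrite /models; do 5!(case/andP=> _); case/andP=> + _.
  have [_ st] := ebE e; have r1 := rank_lt (inr e) (vend2 (eb e)).
  rewrite /= !eqbF_neg !eqb_id orbF (st _ r1).2 (st _ (ltnW r1)).2.
  by rewrite ltnn leqnn.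
have one_vertex p u v : p \in hpoints (vb u) -> p \in hpoints (vb v) -> u = v.
  by rewrite -!vbE; apply: at_most_one_vertex.
exists D => //; split=> [u v uv | e f p ef pe pf | e].
- rewrite disjoint_subset; apply/subsetP => p pu; rewrite inE.
  by apply: contra uv => pv; rewrite (one_vertex p u v).
(* Stated for an ordered pair, to be used in both orders of [e] and [f]. *)
- have not_interior g h : g != h -> p \in vpoints (eb g) -> p \in vpoints (eb h) ->
      p \in vends (eb g).
    move=> gh pg ph; have := hefp (g, h, p); rewrite /models /= (negPf gh) /=.
    case/and3P=> _ + _; rewrite !eqbF_neg orbF.
    rewrite !on_D /= ph /=; have [_ st] := ebE g; have r1 := rank_lt (inr g) p.
    have := opoints_rank D (inr g) p; rewrite /= pg => /esym /andP [l1 l2].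
    have /= st1 := (st _ (ltnW r1)).1; have /= st2 := (st _ r1).2.
    rewrite st1 st2 -!leqNgt => pr.
    exact: (vends_rank (e := g) pg pr).
  have := hefp (e, f, p); rewrite /models /= (negPf ef) /= => /andP [+ _].
  rewrite !eqbF_neg !on_D /= pe pf /= => /hasP [l /mapP [v + ->] /eqP].
  rewrite mem_enum inE => /andP [ve vf] pv; exists v; split=> //.
  + by rewrite -vbE.
  + exact: not_interior pe pf.
  + by apply: not_interior pf pe; rewrite eq_sym.
split.
- have [u ue pu] := anchorP _ _ (anchor1 e); have [v ve pv] := anchorP _ _ (anchor2 e).
  exists u, v; split=> //; rewrite /= in pu pv.
  (* If one vertex held both end points, the vertical bar would lie in one row and be a single
     point. Both end vertices of [e] would touch it there, yet a point carries only one vertex. *)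
  have uv : u != v.
    apply/eqP => uv; rewrite -{v ve}uv in pv.
    have e_point p : p \in vpoints (eb e) -> p = vend1 (eb e).
      move: pu pv; rewrite !inE /= => /andP [/eqP r1 _] /andP [/eqP r2 _].
      move=> /andP [/eqP pc]; have := congr1 val r1; have := congr1 val r2.
      move=> /= e2 e1 pr; case: p pc pr => i j /= -> pr; congr pair.
      by apply: val_inj => /=; lia.
    have e2 : endv e true = endv e false.
      have [p /e_point -> p1] := touchP e (endv e true) ltac:(by rewrite endvE !inE eqxx).
      have [q /e_point -> q1] := touchP e (endv e false) ltac:(by rewrite endvE !inE eqxx orbT).
      exact: one_vertex p1 q1.
    by have := edgesP (valP e); rewrite endvE e2 setUid cards1.
  apply/esym/eqP; rewrite eqEcard cards2 uv (edgesP (valP e)) andbT.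
  by apply/subsetP => x; rewrite !inE => /orP [] /eqP ->.
- apply: leq_trans (few_crossings e).
  (* The default only covers vertices that miss the edge, which are not in [crossed]. *)
  pose meet w := odflt (vend1 (eb e)) [pick p in vpoints (eb e) :&: hpoints (vb w)].
  have meetP w : w \in crossed D e ->
      [/\ w \notin val e, meet w \in vpoints (eb e) & meet w \in hpoints (vb w)].
    rewrite inE /meet => /andP [we]; rewrite -setI_eq0.
    by case: pickP => [p|p0 /set0Pn [p]]; rewrite ?p0 // inE => /andP [].
  rewrite -(card_in_imset (f := meet) (D := mem (crossed D e))); last first.
    move=> w w' /meetP [_ _ h] /meetP [_ _ h'] ww'; rewrite -ww' in h'.
    exact: one_vertex h h'.
  apply/subset_leq_card/subsetP => p /imsetP [w /meetP [we pe pw] pE].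
  rewrite -{}pE in pe pw; rewrite inE.
  (* The last two clauses make an occupied point of [e] a crossing or an anchor; an anchor would put
     an end vertex of [e] where [w] lies. *)
  have := hep (e, p); rewrite /models; do 7!(case/andP=> _); case/and3P => h1 h2 _.
  move: h1 h2; rewrite /= !eqbF_neg !eqb_id !orbF !on_D /= pe (vertex_seen (v := w)) ?vbE //=.
  move=> -> /=; case/orP => // /anchorP [v ve pv].
  by rewrite (one_vertex p w v) ?ve in we.
Qed.

End Soundness.

(** * From drawings to assignments *)

Section Completeness.

Variables (k : nat) (D : drawing G H W).
Hypothesis repr : bar_visibility_representation k D.

(** Every variable receives its intended meaning exactly, although the clauses constrain many
    auxiliary variables in one direction only. *)
Definition assignment (x : variable) : bool :=
  match x with
  | inl (inl (p, o)) => p \in opoints D o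
  | inl (inr (p, i)) =>
      [exists v : G, (enum_rank v < i) && (p \in opoints D (inl v))]
  | inr (inl (o, true, r)) => rank o (first_point D o) < r
  | inr (inl (o, false, r)) => r <= rank o (last_point D o)
  | inr (inr (e, p, a)) =>
      (p \in opoints D (inr e)) &&
      let at_end b := p \in opoints D (inl (endv e b)) in
      let somewhere := [exists v : G, p \in opoints D (inl v)] in
      match a with
      | inl b => at_end b
      | inr None => at_end true || at_end false
      | inr (Some true) => somewhere
      | inr (Some false) => somewhere && ~~ (at_end true || at_end false)
      end
  end.

Arguments assignment : simpl never.

Lemma assignment_on_bar o p : assignment (on_bar o p) = (p \in opoints D o).
Proof. by []. Qed.

Lemma assignment_touch e b p : assignment (touch e b p) =
  (p \in opoints D (inr e)) && (p \in opoints D (inl (endv e b))).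
Proof. by []. Qed.

Lemma assignment_anchor e p : assignment (anchor e p) = (p \in opoints D (inr e)) &&
  ((p \in opoints D (inl (endv e true))) || (p \in opoints D (inl (endv e false)))).
Proof. by []. Qed.

Lemma assignment_occupied e p : assignment (occupied e p) =
  (p \in opoints D (inr e)) && [exists v : G, p \in opoints D (inl v)].
Proof. by []. Qed.

Lemma assignment_crossing e p : assignment (crossing e p) =
  [&& p \in opoints D (inr e), [exists v : G, p \in opoints D (inl v)] &
   ~~ ((p \in opoints D (inl (endv e true))) || (p \in opoints D (inl (endv e false))))].
Proof. by []. Qed.

Lemma assignment_started o r : r <= N ->
  assignment (started o r) = (rank o (first_point D o) < r).
Proof. by move=> rN; rewrite /assignment /= inordK. Qed.

Lemma assignment_unfinished o r : r <= N ->
  assignment (unfinished o r) = (r <= rank o (last_point D o)).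
Proof. by move=> rN; rewrite /assignment /= inordK. Qed.

Lemma assignment_seen p i : i <= #|G| -> assignment (seen p i) =
  [exists v : G, (enum_rank v < i) && (p \in opoints D (inl v))].
Proof. by move=> iG; rewrite /assignment /= inordK. Qed.

Lemma one_vertex p u v : p \in opoints D (inl u) -> p \in opoints D (inl v) -> u = v.
Proof.
move=> pu pv; apply/eqP/negPn/negP => uv; have [/(_ u v uv) + _ _] := repr.
by move=> /pred0P /(_ p) /=; rewrite -/(opoints D (inl u)) pu pv.
Qed.

(** The lower end of the bar may belong to either end vertex, independently of the numbering by
    [endv]. *)
Lemma end_points e b : exists p, p \in vends (edge_bar D e) /\ p \in opoints D (inl (endv e b)).
Proof.
have [_ _ /(_ e) [[u [v [ev pu pv]]] _]] := repr.
have : endv e b \in val e by rewrite endvE; case: b; rewrite !inE eqxx ?orbT.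
rewrite ev !inE => /orP [] /eqP ->.
  by exists (vend1 (edge_bar D e)); split=> //; rewrite !inE eqxx.
by exists (vend2 (edge_bar D e)); split=> //; rewrite !inE eqxx orbT.
Qed.

Lemma vends_sub e p : p \in vends (edge_bar D e) -> p \in opoints D (inr e).
Proof.
by rewrite opoints_rank => /set2P [] ->; rewrite leqnn ?andbT rank_first_last.
Qed.

Lemma vends_anchor e p : p \in vends (edge_bar D e) -> assignment (anchor e p).
Proof.
move=> pe; rewrite assignment_anchor vends_sub //=.
have [_ _ /(_ e) [[u [v [ev pu pv]]] _]] := repr.
have at_end w : w \in val e -> p \in opoints D (inl w) ->
    (p \in opoints D (inl (endv e true))) || (p \in opoints D (inl (endv e false))).
  by rewrite endvE => /set2P [] -> ->; rewrite ?orbT.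
by case/set2P: pe => pE; rewrite pE in at_end *;
  [apply: (at_end u) | apply: (at_end v)]; rewrite // ev !inE eqxx ?orbT.
Qed.

Lemma assignment_models : models base_clauses assignment.
Proof.
have rkN o p : rank o p <= N by apply/ltnW/rank_lt.
have [_ edisj _] := repr.
rewrite /base_clauses !models_cat; apply/and5P; split; last (apply/andP; split);
  apply/models_familyP.
- case=> p v; have vG := ltn_ord (enum_rank v).
  rewrite /models /= !eqb_id !eqbF_neg !orbF ?andbT.
  rewrite (assignment_seen p vG) (assignment_seen p (ltnW vG)) assignment_on_bar.
  apply/and3P; split.
  + rewrite -implybE; apply/implyP => pv; apply/existsP; exists v.
    by rewrite ltnSn pv.
  + rewrite -implybE; apply/implyP => /existsP [w /andP [wv pw]]; apply/existsP; exists w.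
    by rewrite pw ltnW.
  + rewrite -negb_and; apply/negP => /andP [pv /existsP [w /andP [wv pw]]].
    by rewrite (one_vertex pw pv) ltnn in wv.
- move=> o; rewrite /models /= !orbF !eqbF_neg; apply/and3P; split.
  + apply/has_posP; exists (first_point D o).
    by rewrite assignment_on_bar opoints_rank leqnn rank_first_last.
  + by rewrite assignment_started.
  + by rewrite andbT assignment_unfinished // -ltnNge rank_lt.
- case=> o p; rewrite /models all_cat all_nseq /= !eqb_id !eqbF_neg !orbF ?andbT.
  rewrite !assignment_started ?assignment_unfinished ?rank_lt ?rkN //.
  rewrite assignment_on_bar opoints_rank.
  set a := rank o (first_point D o); set b := rank o (last_point D o).
  apply/andP; split; first by lia.
  case p0: (line_start o p) => //=; rewrite -negb_and.
  by have /line_startP := line_first_last D o; apply; rewrite ?rank_first_last.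
- move=> e; rewrite /models /= andbT.
  have touch_end b : exists p, assignment (touch e b p).
    have [p [pe pv]] := end_points e b; exists p.
    by rewrite assignment_touch pv andbT; apply: vends_sub.
  by apply/andP; split; apply/has_posP.
- case=> e p; rewrite /models /edge_point_clauses.
  have rN : rank (inr e) p < N := rank_lt (inr e) p; move: rN.
  set r := rank (inr e) p => rN; rewrite /= !eqb_id !eqbF_neg !orbF ?andbT.
  have anc : p \in vends (edge_bar D e) -> assignment (anchor e p) by apply: vends_anchor.
  have rank_vends : p \in opoints D (inr e) ->
      (r <= rank (inr e) (first_point D (inr e))) ||
      (rank (inr e) (last_point D (inr e)) <= r) -> assignment (anchor e p).
    by move=> pe /(vends_rank pe) /anc.
  have pe : (p \in opoints D (inr e)) = _ := opoints_rank D (inr e) p; have := rank_first_last D (inr e).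
  rewrite !(assignment_started _ rN) !(assignment_started _ (ltnW rN)).
  rewrite !(assignment_unfinished _ rN) !(assignment_unfinished _ (ltnW rN)) => ab.
  rewrite assignment_seen // assignment_occupied assignment_crossing.
  rewrite !assignment_touch !assignment_on_bar.
  have -> : [exists v : G, (enum_rank v < #|G|) && (p \in opoints D (inl v))] =
            [exists v : G, p \in opoints D (inl v)].
    by apply: eq_existsb => v; rewrite ltn_ord.
  (* If the threshold changes at [r], then [p] is the first point of [e] and hence an anchor; the
     last point is treated alike. *)
  have -> : ~~ (rank (inr e) (first_point D (inr e)) < r.+1) ||
     ((rank (inr e) (first_point D (inr e)) < r) || assignment (anchor e p)).
    case: (assignment _) rank_vends; rewrite ?orbT // orbF pe.
    by move: (rank _ _) (rank _ _) ab => a b; lia.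
  have -> : ~~ (r <= rank (inr e) (last_point D (inr e))) ||
     ((r < rank (inr e) (last_point D (inr e))) || assignment (anchor e p)).
    case: (assignment _) rank_vends; rewrite ?orbT // orbF pe.
    by move: (rank _ _) (rank _ _) ab => a b; lia.
  rewrite assignment_anchor.
  move: (p \in _) (p \in _) (p \in _) [exists _, _] => [] [] [] [] //.
- case=> [[e f] p]; rewrite /models /edges_point_clauses; case: (eqVneq e f) => // ef.
  have rN : rank (inr e) p < N := rank_lt (inr e) p.
  have pe : (p \in opoints D (inr e)) = _ := opoints_rank D (inr e) p.
  move: rN pe; set r := rank (inr e) p => rN pe.
  rewrite /= !eqbF_neg !assignment_on_bar andbT orbF.
  rewrite (assignment_started _ (ltnW rN)) (assignment_unfinished _ rN).
  set a := rank _ (first_point _ _) in pe *; set b := rank _ (last_point _ _) in pe *.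
  case pf: (p \in opoints D (inr f)); last by rewrite !orbT.
  (* Away from [e] the second clause holds, as points of [e] on both sides in rank would put [p] on
     [e]. *)
  case eE : (p \in opoints D (inr e)) => /=; last first.
    by move: eE; rewrite pe; lia.
  have [v [ve vf pv pe' pf']] := edisj e f p ef eE pf.
  apply/andP; split.
    apply/hasP; exists (pos (on_bar (inl v) p)); rewrite ?eqb_id //.
    by apply: map_f; rewrite mem_enum inE ve vf.
  (* At an end point, one of the two strict inequalities compares a rank with itself. *)
  by rewrite /a /b /r; case/set2P: pe' => ->; rewrite ltnn ?orbT.
Qed.

(** Sending a crossing point to the vertex on it is injective, because a vertical bar meets a
    horizontal one in at most one point. *)
Lemma assignment_crossings e : #|crossings assignment e| <= k.
Proof.
have [_ _ /(_ e) [_ /(leq_trans _)]] := repr; apply.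
pose vertex_at p := odflt (endv e true) [pick v | p \in opoints D (inl v)].
have atP p : p \in crossings assignment e ->
    [/\ vertex_at p \in crossed D e, p \in opoints D (inr e)
      & p \in opoints D (inl (vertex_at p))].
  rewrite inE assignment_crossing => /and3P [pe /existsP [w pw]].
  rewrite /vertex_at; case: pickP => [v pv|/(_ w)]; last by rewrite [LHS]pw.
  move=> nend; split=> //; rewrite inE endvE !inE; apply/andP; split.
    by apply: contra nend => /orP [] /eqP <-; apply/orP; [left | right]; exact: pv.
  by apply/pred0Pn; exists p; apply/andP.
rewrite -(card_in_imset (f := vertex_at) (D := mem (crossings assignment e))).
  by apply/subset_leq_card/subsetP => v /imsetP [p /atP [+ _ _] ->].
move=> p q /atP [_ pe pv] /atP [_ qe qv] pq; rewrite -{}pq in qv.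
move: (vertex_at p) pe qe pv qv => v; rewrite !inE => /andP [/eqP p2 _] /andP [/eqP q2 _].
move=> /andP [/eqP p1 _] /andP [/eqP q1 _].
by case: p q p1 p2 q1 q2 => [i j] [i' j'] /= -> -> -> ->.
Qed.

End Completeness.

End Formulation.

(** * The two formulations *)

Section Solutions.

Variables (G : graph) (H W k : nat).
Hypotheses (H_gt0 : 0 < H) (W_gt0 : 0 < W).

Local Notation N := (H * W).

(** * Vertex counts and the empty graph *)

Lemma edge_card2 (e : edge G) : #|val e| = 2.
Proof. exact: edgesP (valP e). Qed.

Lemma exists_endv : exists endv : edge G -> bool -> G,
  forall e, val e = [set endv e true; endv e false].
Proof.
apply: (@fin_all_exists (edge G) (fun _ => bool -> G)
  (fun e f => val e = [set f true; f false])) => e.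
have /eqP/cards2P [u [v [_ ->]]] := edge_card2 e.
by exists (fun b => if b then u else v).
Qed.

(** A vertex that is not isolated lies on an edge, and each edge covers two vertices. This turns a
    count of vertices into the quantities of the clause bound. *)
Lemma card_vertices : #|G| <= #|isolated G| + 2 * #|edges G|.
Proof.
have cov : [set: G] \subset isolated G :|: cover (edges G).
  apply/subsetP => v _; rewrite !inE; case: forallP => //= h.
  apply: contraT => nv; case: h => e; apply/implyP => eE.
  by apply: contra nv => ve; apply/bigcupP; exists e.
rewrite -cardsT; apply: leq_trans (subset_leq_card cov) _.
rewrite cardsU; apply: leq_trans (leq_subr _ _) _; rewrite leq_add2l.
apply: leq_trans (leq_card_cover _) _.
rewrite (eq_bigr (fun=> 2)) => [|e /edgesP //].
by rewrite sum_nat_const mulnC.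
Qed.

(** This makes the clause bound positive for a nonempty graph, so that a constant number of clauses
    fits. *)
Lemma card_edges_isolated : 0 < #|G| -> 0 < #|edges G| ^ 2 + #|isolated G|.
Proof.
move=> G_gt0; have := card_vertices; case: #|edges G| => [|m]; last by rewrite expnS.
by rewrite muln0 addn0 => /(leq_trans G_gt0).
Qed.

Lemma edge_empty : #|G| = 0 -> edge G -> False.
Proof.
move=> G0 e; have /eqP/cards2P [u _] := edge_card2 e.
by have := max_card (pred1 u); rewrite card1 G0.
Qed.

Lemma empty_drawing : #|G| = 0 -> exists D : drawing G H W, bar_visibility_representation k D.
Proof.
move=> G0; have noV (v : G) : False by have := max_card (pred1 v); rewrite card1 G0.
exists (Drawing (fun v => match noV v with end) (fun e => match edge_empty G0 e with end)).
by split=> [u | e | e]; [case: (noV u) | case: (edge_empty G0 e) | case: (edge_empty G0 e)].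
Qed.

(** The first points of disjoint bars are distinct. *)
Lemma vertices_le_points (D : drawing G H W) : bar_visibility_representation k D -> #|G| <= N.
Proof.
case=> disj _ _; rewrite -(card_point H W).
apply: (leq_card (fun v : G => first_point D (inl v))) => u v uv.
have first_on w : first_point D (inl w) \in hpoints (vertex_bar D w).
  by rewrite inE /= eqxx leqnn hbarP.
apply/eqP/negPn/negP => /disj /pred0P /(_ (first_point D (inl u))).
by rewrite [LHS]/= first_on [X in X \in _]uv first_on.
Qed.

(** * The integer program *)

Definition crossing_bounds : seq ({set variable G H W} * nat) :=
  [seq ([set crossing e p | p : point H W], k) | e <- enum {: edge G}].

Lemma crossing_boundsP (s : variable G H W -> bool) :
  (forall A, A \in crossing_bounds -> #|[set v in A.1 | s v]| <= A.2) <->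
  (forall e, #|crossings s e| <= k).
Proof.
have cardE e : #|[set v in [set crossing e p | p : point H W] | s v]| = #|crossings s e|.
  rewrite -(card_imset (f := @crossing G H W e)) => [|p q [] //].
  apply: eq_card => v; rewrite inE; apply/andP/imsetP => [[/imsetP [p _ ->] sv]|[p + ->]].
    by exists p; rewrite ?inE.
  by rewrite inE => sp; split=> //; apply: imset_f.
split=> [h e | h A /mapP [e _ ->] /=]; last by rewrite cardE.
by rewrite -cardE; apply: (h (_, k)); apply: map_f; rewrite mem_enum.
Qed.

Lemma ilp_solution : exists P : ilp,
  [/\ @ilp_solves G H W k P,
      ilp_vars P <= 12 * (N * (#|G| + #|edges G|)) &
      ilp_cons P <= 100 * (N * (#|edges G| ^ 2 + #|G|))].
Proof.
have [G0|G_gt0] := posnP #|G|.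
  (* Without vertices the bounds allow no variable and no constraint, and the empty drawing is a
     representation. *)
  exists (@ILP 0 0 0 0)%R; split=> //.
  have noV (v : G) : False by have := max_card (pred1 v); rewrite card1 G0.
  exists (fun _ v => match noV v with end), (fun _ e => match edge_empty G0 e with end).
  have [D hD] := empty_drawing G0.
  split=> [x _ | D' hD']; [exists D => // | exists 0%R; first by case].
    by split=> p; [move=> v; case: (noV v) | move=> e; case: (edge_empty G0 e)].
  by split=> p; [move=> v; case: (noV v) | move=> e; case: (edge_empty G0 e)].
have [endv endvE] := exists_endv.
exists (cnf_ilp (base_clauses H W endv) crossing_bounds); split.
- exists (fun p v => enum_rank (on_bar (inl v) p)), (fun p e => enum_rank (on_bar (inr e) p)).
  split=> [x /cnf_ilpP [s [xE sF /crossing_boundsP sK]] | D hD].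
    have [D hD on_D] := sound_drawing H_gt0 W_gt0 endvE sF sK.
    by exists D => //; split=> p o; rewrite xE on_D.
  exists (\col_i (assignment endv D (enum_val i))%:R)%R.
    apply/cnf_ilpP; exists (assignment endv D); split.
    + by move=> v; rewrite mxE enum_rankK.
    + exact: assignment_models hD.
    + by apply/crossing_boundsP; exact: assignment_crossings.
  by split=> p o; rewrite mxE enum_rankK.
- exact: card_variable.
(* There are two bounds per variable, one inequality per clause and one per edge; terms linear in
   the number of edges are absorbed by its square. *)
- apply: leq_trans (ilp_cons_cnf _ _) _.
  rewrite size_map -cardE card_edge.
  have := card_variable H_gt0 W_gt0 G_gt0; have := size_base H_gt0 W_gt0 endv.
  have : N * #|edges G| <= N * #|edges G| ^ 2.
    by rewrite leq_mul2l -mulnn; nia.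
  have : #|edges G| <= N * #|edges G| by rewrite leq_pmull ?N_gt0.
  lia.
Qed.

(** * Clauses for a grid with more than two points *)

Definition crossing_clauses : seq (seq (variable G H W * bool)) :=
  [seq [seq neg (crossing e p) | p <- enum (A : {set point H W})]
     | e <- enum {: edge G}, A <- enum [set A : {set point H W} | #|A| == k.+1]].

Lemma crossing_clausesP (s : variable G H W -> bool) :
  models crossing_clauses s <-> (forall e, #|crossings s e| <= k).
Proof.
split=> [/allP h e | h]; last first.
  apply/allP => _ /allpairsP [[e A] /= [_ + ->]]; rewrite mem_enum inE => /eqP Ak.
  have := h e; rewrite leqNgt -Ak; apply: contraR => /hasPn hn.
  apply/subset_leq_card/subsetP => p pA; rewrite inE.
  have := hn (neg (crossing e p)); rewrite /= eqbF_neg negbK; apply.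
  by apply: map_f; rewrite mem_enum.
(* More than [k] crossings include [k.+1] distinct ones, and the clause of these is violated. *)
rewrite leqNgt; apply/negP => /card_geqP [r [r_uniq r_size r_sub]].
have /hasP [_ /mapP [p + ->]] : has (fun l => s l.1 == l.2)
    [seq neg (crossing e p) | p <- enum [set p in r]].
  apply: h; apply: allpairs_f; rewrite mem_enum // inE cardsE.
  by rewrite (card_uniqP r_uniq) r_size.
by rewrite mem_enum inE => /r_sub; rewrite inE /= => ->.
Qed.

Lemma size_crossing_clauses : size crossing_clauses = 'C(N, k.+1) * #|edges G|.
Proof. by rewrite size_allpairs -!cardE card_edge card_draws card_point mulnC. Qed.

Lemma crossing_clause_size c : c \in crossing_clauses -> size c <= N.
Proof.
case/allpairsP => -[e A] /= [_ _ ->]; rewrite size_map -cardE -(card_point H W).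
exact: max_card.
Qed.

Lemma sat_solution_large : 2 < N -> 0 < #|G| -> exists F : sat,
  [/\ @sat_solves G H W k F,
      sat_vars F <= 12 * (N * (#|G| + #|edges G|)),
      size (clauses F) <=
        100 * ('C(N, k.+1) * #|edges G| + N * (#|edges G| ^ 2 + #|isolated G|)) &
      forall c, c \in clauses F -> size c <= N].
Proof.
move=> N_gt2 G_gt0; have [endv endvE] := exists_endv.
exists (cnf_sat (base_clauses H W endv ++ crossing_clauses)); split.
- exists (fun p v => enum_rank (on_bar (inl v) p)), (fun p e => enum_rank (on_bar (inr e) p)).
  split=> [s | D hD].
    rewrite satisfies_cnf models_cat => /andP [sF /crossing_clausesP sK].
    have [D hD on_D] := sound_drawing H_gt0 W_gt0 endvE sF sK.
    by exists D => //; split=> p o; exact: on_D.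
  exists (assignment endv D \o enum_val).
    rewrite satisfies_cnf.
    have -> : models (base_clauses H W endv ++ crossing_clauses)
        ((assignment endv D \o enum_val) \o enum_rank) =
      models (base_clauses H W endv ++ crossing_clauses) (assignment endv D).
      by apply: eq_all => c; apply: eq_has => l; rewrite /= enum_rankK.
    rewrite models_cat (assignment_models H_gt0 W_gt0 endvE hD) /=.
    by apply/crossing_clausesP; exact: assignment_crossings.
  by split=> p o; rewrite /= enum_rankK.
- exact: card_variable.
- rewrite size_map size_cat size_crossing_clauses.
  have := size_base H_gt0 W_gt0 endv.
  have : N * #|edges G| <= N * #|edges G| ^ 2.
    by rewrite leq_mul2l -mulnn; nia.
  have : N * #|G| <= N * (#|isolated G| + 2 * #|edges G|).
    by rewrite leq_mul2l card_vertices orbT.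
  move: ('C(_, _) * _) => b; lia.
- move=> _ /mapP [c + ->]; rewrite size_map mem_cat => /orP [/base_clause_size|].
    by rewrite (maxn_idPr _).
  exact: crossing_clause_size.
Qed.

End Solutions.

(** * Clauses for a grid with at most two points *)

Section SmallGrid.

Variables (G : graph) (H W k : nat).
Hypotheses (H_gt0 : 0 < H) (W_gt0 : 0 < W).
Hypotheses (G_gt0 : 0 < #|G|) (G_le : #|G| <= H * W) (N_le2 : H * W <= 2).

Local Notation N := (H * W).
Local Notation pt := (point H W).
Local Notation representation := (bar_visibility_representation k).

Definition small_variable : finType := (pt * object G)%type.

Definition bar_values (D : drawing G H W) (x : small_variable) : bool :=
  x.1 \in opoints D x.2.

Lemma two_points (p q r : pt) : p != q -> (r == p) || (r == q).
Proof.
move=> pq; apply: contraT; rewrite negb_or => /andP [rp rq].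
have : #|[set r; p; q]| <= 2 by rewrite (leq_trans (max_card _)) ?card_point.
by rewrite -setUA cardsU1 !inE negb_or rp rq cards2 pq.
Qed.

(** Two disjoint nonempty bars on at most two points take one point each and so fill the grid. *)
Lemma other_vertex (D : drawing G H W) (u v : G) (p : pt) : representation D -> u != v ->
  (p \in opoints D (inl v)) = (p \notin opoints D (inl u)).
Proof.
case=> disj _ _ uv; have /pred0P d := disj u v uv.
have first_on w : first_point D (inl w) \in opoints D (inl w).
  by rewrite inE /= eqxx leqnn hbarP.
have dF q : q \in opoints D (inl u) -> q \in opoints D (inl v) -> false.
  by move=> qu qv; have <- : _ = false := d q; apply/andP.
case pu: (p \in opoints D (inl u)) => /=; first by apply/negP => /(dF p pu).
have neq : first_point D (inl u) != first_point D (inl v).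
  by apply/eqP => e; have := dF _ (first_on u); rewrite e => /(_ (first_on v)).
case/orP: (two_points p neq) => /eqP pE; last by rewrite pE first_on.
by rewrite pE first_on in pu.
Qed.

(** The end points of an edge lie on disjoint vertex bars, so they are two distinct points and
    exhaust the grid. *)
Lemma full_edge (D : drawing G H W) e p : representation D -> p \in opoints D (inr e).
Proof.
case=> disj _ /(_ e) [[u [v [ev pu pv]]] _].
have uv : u != v.
  by apply/eqP => uv; have := edge_card2 e; rewrite ev uv setUid cards1.
have neq : vend1 (edge_bar D e) != vend2 (edge_bar D e).
  apply/eqP => E; have /pred0P /(_ (vend1 (edge_bar D e))) := disj u v uv.
  by rewrite /= pu E pv.
case/orP: (two_points p neq) => /eqP ->; rewrite inE /= eqxx ?leqnn ?vbarP //.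
Qed.

(** [F] consists of all clauses of length [N] that hold in every representation. A model agrees with
    some representation on any [N] variables, since otherwise the clause negating its values there
    would belong to [F]. *)
Lemma all_implied_clauses : exists F : seq (seq (small_variable * bool)),
  [/\ forall c, c \in F -> size c = N, size F <= #|{: N.-tuple (small_variable * bool)}|,
      forall D, representation D -> models F (bar_values D) &
      forall s, models F s -> forall r : seq small_variable, size r = N ->
        exists2 D, representation D & {in r, forall x, s x = bar_values D x}].
Proof.
pose implied (c : seq (small_variable * bool)) :=
  forall D, representation D -> has (fun l => bar_values D l.1 == l.2) c.
(* Being implied quantifies over all drawings; classical logic turns it into a boolean predicate on
   the finite type of clauses. *)
have [b bP] : exists b : N.-tuple (small_variable * bool) -> bool,
    forall t, b t <-> implied t.
  have := @fin_all_exists {: N.-tuple (small_variable * bool)} (fun=> bool)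
    (fun t b => is_true b <-> implied t).
  apply=> t.
  by case: (classic (implied t)) => h; [exists true | exists false].
exists [seq tval t | t <- enum b]; split.
- by move=> _ /mapP [t _ ->]; rewrite size_tuple.
- by rewrite size_map -cardE max_card.
- move=> D hD; apply/allP => _ /mapP [t + ->].
  by rewrite mem_enum => /bP /(_ D hD).
- move=> s sF r rN; apply: NNPP => nD.
  have tP : size [seq (x, ~~ s x) | x <- r] == N by rewrite size_map rN.
  have /(allP sF) : [seq (x, ~~ s x) | x <- r] \in [seq tval t | t <- enum b].
    apply/mapP; exists (Tuple tP) => //; rewrite mem_enum; apply/bP => D hD.
    apply: contraT => /hasPn nh; case: nD; exists D => // x xr.
    have := nh _ (map_f (fun x => (x, ~~ s x)) xr); rewrite /=.
    by case: (s x); case: (bar_values D x).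
  by case/hasP => _ /mapP [x _ ->] /=; case: (s x).
Qed.

(** Agreement on [N] variables suffices: a single object has [N] of them, edges fill the grid in
    every representation, and a second vertex is the complement of the first. *)
Lemma small_sound (s : small_variable -> bool) :
  (forall r : seq small_variable, size r = N ->
     exists2 D, representation D & {in r, forall x, s x = bar_values D x}) ->
  exists2 D, representation D & s =1 bar_values D.
Proof.
move=> hs.
have bar_agrees o : exists2 D, representation D & forall p, s (p, o) = (p \in opoints D o).
  have [|D hD hr] := hs [seq (p, o) | p <- enum {: pt}].
    by rewrite size_map -cardE card_point.
  by exists D => // p; apply: hr; apply: map_f; rewrite mem_enum.
have /card_gt0P [u _] := G_gt0.
have [D hD sD] := bar_agrees (inl u); exists D => // -[p [v|e]]; rewrite /bar_values /=.
  have [<-|uv] := eqVneq u v; first exact: sD.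
  have N2 : N = 2.
    apply/eqP; rewrite eqn_leq N_le2 (leq_trans _ G_le) //.
    by have := max_card [set u; v]; rewrite cards2 uv.
  have [//|D' hD' hr] := hs [:: (p, inl u); (p, inl v)].
  have su : s (p, inl u) = (p \in opoints D' (inl u)) by apply: hr; rewrite !inE eqxx.
  have sv : s (p, inl v) = (p \in opoints D' (inl v)).
    by apply: hr; rewrite !inE eqxx orbT.
  rewrite sv (other_vertex p hD' uv) -su sD; exact/esym/(other_vertex p hD uv).
have [D' hD' ->] := bar_agrees (inr e).
by rewrite (full_edge e p hD') (full_edge e p hD).
Qed.

Lemma card_small_variable : #|small_variable| = N * (#|G| + #|edges G|).
Proof. by rewrite card_prod card_point card_sum card_edge. Qed.

(** At most two vertices have at most four sets as edges, hence at most 2 * (2 + 4) * 2 = 24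
    literals, and 576 is the square of 24. *)
Lemma few_clauses : #|{: N.-tuple (small_variable * bool)}| <= 576.
Proof.
have m_le : #|edges G| <= 4.
  apply: leq_trans (max_card _) _; rewrite -cardsT -powersetT card_powerset cardsT.
  by rewrite (leq_pexp2l (m := 2) (n2 := 2)) // (leq_trans G_le).
rewrite card_tuple card_prod card_bool card_small_variable.
have n_le := leq_trans G_le N_le2.
have v_le : N * (#|G| + #|edges G|) * 2 <= 24 by nia.
case: N N_le2 v_le => [|[|[|//]]] _ // v_le; first by rewrite expn1 (leq_trans v_le).
by rewrite -mulnn (leq_mul v_le v_le).
Qed.

Lemma sat_solution_small : exists F : sat,
  [/\ @sat_solves G H W k F, sat_vars F <= N * (#|G| + #|edges G|),
      size (clauses F) <= 576 & forall c, c \in clauses F -> size c <= N].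
Proof.
have [F [F_clause F_size F_complete F_sound]] := all_implied_clauses.
exists (cnf_sat F); split.
- exists (fun p v => enum_rank ((p, inl v) : small_variable)),
         (fun p e => enum_rank ((p, inr e) : small_variable)).
  split=> [s /satisfies_cnf /F_sound /small_sound [D hD sD] | D hD].
    by exists D => //; split=> p o; [apply: (sD (p, inl o)) | apply: (sD (p, inr o))].
  exists (bar_values D \o enum_val); last by split=> p o; rewrite /= enum_rankK.
  apply/satisfies_cnf; have := F_complete D hD.
  by congr is_true; apply: eq_all => c; apply: eq_has => l; rewrite /= enum_rankK.
- by rewrite /= card_small_variable.
- by rewrite size_map (leq_trans F_size) ?few_clauses.
- by move=> _ /mapP [c cF ->]; rewrite size_map F_clause.
Qed.

End SmallGrid.

(** * The SAT formulation for all grids *)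

Lemma sat_solution (G : graph) (H W k : nat) : 0 < H -> 0 < W -> exists F : sat,
  [/\ @sat_solves G H W k F,
      sat_vars F <= 576 * (H * W * (#|G| + #|edges G|)),
      size (clauses F) <=
        576 * ('C(H * W, k.+1) * #|edges G| + H * W * (#|edges G| ^ 2 + #|isolated G|)) &
      forall c, c \in clauses F -> size c <= H * W].
Proof.
move=> H_gt0 W_gt0.
have [G0|G_gt0] := posnP #|G|.
  exists (@SAT 0 [::]); split=> //.
  have noV (v : G) : False by have := max_card (pred1 v); rewrite card1 G0.
  exists (fun _ v => match noV v with end), (fun _ e => match edge_empty G0 e with end).
  have [D hD] := empty_drawing H W k G0.
  split=> [x _ | D' hD']; [exists D => // | exists (fun=> true) => //].
    by split=> p; [move=> v; case: (noV v) | move=> e; case: (edge_empty G0 e)].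
  by split=> p; [move=> v; case: (noV v) | move=> e; case: (edge_empty G0 e)].
have [N_gt2|N_le2] := ltnP 2 (H * W).
  have [F [h1 h2 h3 h4]] := sat_solution_large k H_gt0 W_gt0 N_gt2 G_gt0.
  by exists F; split=> //; [apply: leq_trans h2 _ | apply: leq_trans h3 _]; rewrite leq_mul2r orbT.
have pos : 0 < H * W * (#|edges G| ^ 2 + #|isolated G|).
  by rewrite muln_gt0 N_gt0 // card_edges_isolated.
(* A representation bounds the number of vertices by the number of points, as the clauses for small
   grids require. *)
have [[D hD]|noD] := classic (exists D : drawing G H W, bar_visibility_representation k D).
  have [F [h1 h2 h3 h4]] :=
    sat_solution_small k H_gt0 W_gt0 G_gt0 (vertices_le_points hD) N_le2.
  exists F; split=> //; first by rewrite (leq_trans h2) // leq_pmull.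
  by rewrite (leq_trans h3) // leq_pmulr // addn_gt0 pos orbT.
have /card_gt0P [v0 _] := G_gt0.
(* Without a representation, the empty clause makes the formulation unsatisfiable; the variables
   remain so that points on bars can be located. *)
exists (@SAT #|small_variable G H W| [:: [::]]); split.
- exists (fun p v => enum_rank ((p, inl v) : small_variable G H W)),
         (fun p e => enum_rank ((p, inr e) : small_variable G H W)).
  by split=> // D hD; case: noD; exists D.
- by rewrite /= card_small_variable leq_pmull.
- by rewrite /= muln_gt0 /= addn_gt0 pos orbT.
- by move=> c; rewrite inE => /eqP ->.
Qed.

Theorem theorem5 :
  (exists C : nat, forall (G : graph) (H W k : nat),
     0 < H -> 0 < W -> 1 <= k ->
     exists P : ilp,
       [/\ @ilp_solves G H W k P,
           ilp_vars P <= C * (H * W * (#|G| + #|edges G|))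
         & ilp_cons P <= C * (H * W * (#|edges G| ^ 2 + #|G|))]) /\
  (exists C : nat, forall (G : graph) (H W k : nat),
     0 < H -> 0 < W -> 1 <= k ->
     exists F : sat,
       [/\ @sat_solves G H W k F,
           sat_vars F <= C * (H * W * (#|G| + #|edges G|)),
           size (clauses F) <=
             C * ('C(H * W, k.+1) * #|edges G|
                  + H * W * (#|edges G| ^ 2 + #|isolated G|))
         & forall c, c \in clauses F -> size c <= H * W]).
Proof.
split.
  (* One constant serves both bounds, the larger being that for constraints. *)
  exists 100 => G H W k H_gt0 W_gt0 _.
  have [P [h1 h2 h3]] := ilp_solution G k H_gt0 W_gt0.
  by exists P; split=> //; apply: leq_trans h2 _; rewrite leq_mul2r orbT.
by exists 576 => G H W k H_gt0 W_gt0 _; apply: sat_solution.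
Qed.
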